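(* Let $k\in\mathbb Z$, let $z\in\mathbb C\setminus\mathbb R$, and let $q\in\mathbb C$ with $|q|<1$. If $k$ is odd, then $\mathscr G_k(z,q)=0$. For even weights, $\mathscr G_{2k}(z,q)$ (with $k\in\mathbb Z$ arbitrary) satisfies: (i) $\mathscr G_{2k}\left(-\frac1z,q\right)=z^{2k}\,\mathscr G_{2k}(z,q)$; (ii) $\mathscr G_{2k}(-z,q)=\mathscr G_{2k}(z,q)$.
   Context: A partition $\lambda=(\lambda_1,\lambda_2,\dots,\lambda_r)$ is a finite sequence of integers with $\lambda_1\geq\lambda_2\geq\dots\geq\lambda_r\geq 1$; $r\geq 0$ is its length, and the empty partition $\emptyset$ (with $r=0$) is allowed. The size of $\lambda$ is $|\lambda|=\lambda_1+\dots+\lambda_r$, $\lambda\vdash n$ means that $\lambda$ is a partition with $|\lambda|=n$ (so $\emptyset\vdash 0$), and $\mathcal P$ denotes the set of all partitions. For $z\in\mathbb C\setminus\mathbb R$, the Ferrers-Young lattice of $\lambda$ is the finite set of complex numbers $$\mathscr F(\lambda,z)=\{az+b:\ a,b\in\mathbb Z,\ 1\leq|b|\leq r,\ 1\leq|a|\leq\lambda_{|b|}\}.$$ For $k\in\mathbb Z$, the single-partition Eisenstein series is $$f_k(\lambda,z)=\frac14\sum_{\omega\in\mathscr F(\lambda,z)}\omega^{-k},\qquad f_k(\emptyset,z)=0,$$ and the partition Eisenstein series is, for $n\geq1$, $$g_k(n,z)=\sum_{\lambda\vdash n}f_k(\lambda,z),\qquad\text{with } g_k(0,z)=0.$$ For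 $z\in\mathbb C\setminus\mathbb R$ and $q\in\mathbb C$ with $|q|<1$, define the generating function $$\mathscr G_k(z,q)=\sum_{n\geq1}g_k(n,z)\,q^n=\sum_{\lambda\in\mathcal P}f_k(\lambda,z)\,q^{|\lambda|}.$$ *)

(* Defs.v *)
From mathcomp Require Import all_boot all_order all_algebra.
From mathcomp Require Import complex.
From mathcomp Require Import all_classical all_reals all_analysis.

Set Implicit Arguments.
Unset Strict Implicit.
Unset Printing Implicit Defensive.

Import Order.TTheory GRing.Theory Num.Theory.
Import numFieldNormedType.Exports.

Local Open Scope classical_set_scope.
Local Open Scope ring_scope.

(* The complex numbers are [R[i]] for an arbitrary [R : realType].            *)

Definition is_partition (la : seq nat) : bool :=
  sorted geq la && (0%N \notin la).

Definition partitions_of (n : nat) : set (seq nat) :=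
  [set la | is_partition la /\ sumn la = n].

(* Parts are numbered from 0, so the part with number |b| is [nth _ _ |b|.-1]. *)
Definition ferrers_young (R : realType) (la : seq nat) (z : R[i]) : set R[i] :=
  [set w | exists a b : int,
     [/\ w = a%:~R * z + b%:~R,
         (1 <= `|b| <= size la)%N &
         (1 <= `|a| <= nth 0 la `|b|.-1)%N] ].

Definition eisenstein_part (R : realType) (k : int) (la : seq nat) (z : R[i]) :
    R[i] :=
  4%:R^-1 * \sum_(w \in ferrers_young la z) w ^ (- k).

Definition partition_eisenstein (R : realType) (k : int) (n : nat) (z : R[i]) :
    R[i] :=
  \sum_(la \in partitions_of n) eisenstein_part k la z.

(* [R[i]^o] is [R[i]] with the topology of its modulus.                       *)
Definition eisenstein_gf_partial (R : realType) (k : int) (z q : R[i])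
    (N : nat) : R[i]^o :=
  \sum_(1 <= n < N) partition_eisenstein k n z * q ^+ n.

(* As a total function, [eisenstein_gf] is meaningful only where the partial  *)
(* sums converge.                                                             *)
Definition eisenstein_gf (R : realType) (k : int) (z q : R[i]) : R[i] :=
  limn (eisenstein_gf_partial k z q).

(* Main.v *)
Require Import Defs.
From mathcomp Require Import all_boot all_order all_algebra.
From mathcomp Require Import complex.
From mathcomp Require Import all_classical all_reals all_analysis.
From mathcomp Require Import ring lra zify.

Import Order.TTheory GRing.Theory Num.Theory.
Import numFieldNormedType.Exports.

Local Open Scope ring_scope.

(** The symmetries hold coefficient by coefficient, before any limit is taken.
    The lattice of [la] is stable under [w |-> - w] and under [z |-> - z], by
    changing the signs of [a] and [b]. The first symmetry kills the odd weights
    and the second gives the evenness in [z]. As for the inversion,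
    [a * (- 1 / z) + b = (b * z - a) / z], so the lattice of [la] at [- 1 / z]
    is [z^-1] times the lattice at [z] of the conjugate partition, in which
    rows and columns are exchanged ([ferrers_young_inv]). Conjugation permutes
    the partitions of [n], and summing over them gives
    [partition_eisenstein_inv].

    It remains to see that the series converges. Lattice points of a partition
    of [n] have modulus between [`|Im z|] and [n * (`|z| + 1)], so each
    [eisenstein_part] is bounded by a polynomial in [n] ([eisenstein_part_le]).
    The number of partitions of [n] is subexponential: it is at most [C * s ^ n]
    for every [s > 1] ([partition_list]), where [C] bounds the Euler product
    [\prod_(i >= 1) (1 - s^-i)^-1]. Hence the coefficients of the generating
    function are at most [C * t ^ n] for every [t > 1], and the choice
    [t = 2 / (1 + `|q|)] makes [t * `|q| < 1], which leaves a geometric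
    series. *)

(** * Conjugate partitions *)

Definition conj_part (la : seq nat) : seq nat :=
  mkseq (fun j => count (ltn j) la) (head 0 la).

(** Parts larger than [j] come first in a nonincreasing list, so more than [i]
    of them exist exactly when the part of index [i] is one of them. *)
Lemma lt_count_nth {la : seq nat} (i j : nat) : sorted geq la ->
  (i < count (ltn j) la)%N = (j < nth 0%N la i)%N.
Proof.
have geq_tr : transitive geq by move=> y x z /= yx zy; exact: leq_trans zy yx.
elim: la i => [|x la IH] i; first by rewrite nth_nil.
rewrite /= path_sortedE // => /andP[/allP xla sla].
have small l : (x <= j)%N -> (nth 0%N la l <= j)%N.
  move=> xj; case: (ltnP l (size la)) => [/(mem_nth 0%N)/xla /= lx|?].
    exact: leq_trans lx xj.
  by rewrite nth_default.
have [jx|xj] := ltnP j x; first by case: i => [|i] //=; rewrite add1n ltnS IH.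
by rewrite add0n IH //; case: i => [|i] /=;
   rewrite ltnNge small //= ltnNge ?xj ?small.
Qed.

Lemma nth_gt0_part {la : seq nat} (i : nat) : is_partition la ->
  (0 < nth 0%N la i)%N = (i < size la)%N.
Proof.
move=> /andP[_ la0]; case: (ltnP i (size la)) => [|?]; last by rewrite nth_default.
by move=> /(mem_nth 0%N) ila; rewrite lt0n; apply: contraNneq la0 => <-.
Qed.

(** The diagram of [conj_part la] is the transpose of that of [la]; the default
    value [0] of [nth] stands for the empty rows. *)
Lemma nth_conj_part {la : seq nat} (i j : nat) : is_partition la ->
  (i < nth 0%N (conj_part la) j)%N = (j < nth 0%N la i)%N.
Proof.
move=> /andP[sla _]; rewrite -(lt_count_nth i j sla) /conj_part.
case: (ltnP j (head 0%N la)) => jla; first by rewrite nth_mkseq.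
rewrite nth_default ?size_mkseq // ltn0; apply/esym/negbTE; rewrite -leqNgt.
apply: (@leq_trans 0%N) => //; rewrite leqNgt lt_count_nth // -leqNgt.
by rewrite nth0.
Qed.

Lemma eq_part_diagram {la mu : seq nat} : is_partition la -> is_partition mu ->
  (forall i j, (j < nth 0%N la i)%N = (j < nth 0%N mu i)%N) -> la = mu.
Proof.
move=> pla pmu E; have En i : nth 0%N la i = nth 0%N mu i.
  by apply/anti_leq; rewrite leqNgt E ltnn leqNgt -E ltnn.
suff Es : size la = size mu by apply: (eq_from_nth Es) => i _; exact: En.
have Elt i : (i < size la)%N = (i < size mu)%N by rewrite -!nth_gt0_part ?En.
by apply/anti_leq; rewrite leqNgt Elt ltnn leqNgt -Elt ltnn.
Qed.

Lemma conj_part_partition {la : seq nat} : is_partition la ->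
  is_partition (conj_part la).
Proof.
move=> pla; apply/andP; split.
  apply: (path_sorted (x := count (ltn 0) la)); rewrite -/conj_part.
  apply/(pathP 0%N) => i; rewrite size_mkseq => ila.
  suff le_count a b : (a <= b)%N -> (count (ltn b) la <= count (ltn a) la)%N.
    rewrite nth_mkseq //; case: i ila => [|i] ila /=; first exact: le_count.
    by rewrite nth_mkseq ?le_count // ltnW.
  by move=> ab; apply: sub_count => x /=; exact: leq_ltn_trans.
apply/negP => /(nthP 0%N)[j]; rewrite size_mkseq => jla c0.
by have := nth_conj_part 0 j pla; rewrite c0 ltnn nth0 jla.
Qed.

Lemma conj_partK {la : seq nat} : is_partition la ->
  conj_part (conj_part la) = la.
Proof.
move=> pla; have pc := conj_part_partition pla.
apply: eq_part_diagram => //; first exact: conj_part_partition.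
by move=> i j; rewrite !nth_conj_part.
Qed.

(** Written over a square of side [N], the count of boxes is visibly invariant
    under transposition of the diagram. *)
Lemma sumn_diagram {la : seq nat} {N : nat} :
  (size la <= N)%N -> (forall i, nth 0%N la i <= N)%N ->
  sumn la = (\sum_(i < N) \sum_(j < N) (j < nth 0%N la i))%N.
Proof.
move=> sN nN; rewrite sumnE (big_nth 0%N) (big_nat_widen _ _ _ _ _ sN) /=.
rewrite big_mkord big_mkcond; apply: eq_bigr => i _; case: ifPn => [_|].
  rewrite -(big_mkord xpredT (fun j => nat_of_bool (j < nth 0%N la i)%N)).
  rewrite (big_cat_nat (n := nth 0%N la i)) //=.
  rewrite [X in (_ + X)%N]big_nat_cond [X in (_ + X)%N]big1 => [|j].
    rewrite addn0 (eq_big_nat _ _ (F2 := fun=> 1%N)).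
      by rewrite sum_nat_const_nat muln1 subn0.
    by move=> j /andP[_ ->].
  by case/andP => /andP[h _] _; rewrite ltnNge h.
by rewrite -leqNgt => /(nth_default 0%N) ->; rewrite big1.
Qed.

Lemma sumn_conj_part {la : seq nat} : is_partition la ->
  sumn (conj_part la) = sumn la.
Proof.
move=> pla; have [sla _] := andP pla.
have nthla i : (nth 0%N la i <= head 0%N la)%N.
  have [//|] := leqP; rewrite -lt_count_nth // => h.
  have : (0 < count (ltn (head 0%N la)) la)%N by exact: leq_ltn_trans h.
  by rewrite lt_count_nth // nth0 ltnn.
set N := maxn (size la) (head 0%N la).
rewrite (@sumn_diagram la N) ?leq_maxl //; last first.
  by move=> i; rewrite leq_max nthla orbT.
rewrite (@sumn_diagram (conj_part la) N).
- rewrite exchange_big; apply: eq_bigr => i _; apply: eq_bigr => j _.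
  by rewrite nth_conj_part.
- by rewrite size_mkseq leq_maxr.
- move=> j; rewrite leqNgt nth_conj_part // nth_default //.
  exact: leq_maxl.
Qed.

(** * Symmetries of the Ferrers-Young lattice *)

(** In this form both conditions on the box [(`|b|.-1, `|a|.-1)] become the
    membership in the diagram, which conjugation transposes. *)
Lemma ferrers_youngE {R : realType} {la : seq nat} {z w : R[i]} :
  is_partition la ->
  ferrers_young la z w <->
  exists a b : int, [/\ w = a%:~R * z + b%:~R, a != 0, b != 0 &
    (`|a|.-1 < nth 0%N la `|b|.-1)%N].
Proof.
move=> pla; split=> -[a [b]].
  case=> -> /andP[b0 bs] /andP[a0 al]; exists a, b; split=> //.
  - by rewrite -absz_gt0.
  - by rewrite -absz_gt0.
  - by rewrite prednK.
rewrite -absz_gt0 -(absz_gt0 b) => -[-> a0 b0 al]; exists a, b; split=> //.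
  by rewrite b0 -(prednK b0) -nth_gt0_part //; exact: leq_ltn_trans al.
by rewrite a0 -{1}(prednK a0).
Qed.

Lemma ferrers_youngN {R : realType} (la : seq nat) (z w : R[i]) :
  ferrers_young la z w -> ferrers_young la z (- w).
Proof.
move=> [a [b [-> bs al]]]; exists (- a), (- b); split; rewrite ?abszN //.
by rewrite !rmorphN mulNr opprD.
Qed.

Lemma ferrers_young_opp {R : realType} (la : seq nat) (z w : R[i]) :
  ferrers_young la z w -> ferrers_young la (- z) w.
Proof.
move=> [a [b [-> bs al]]]; exists (- a), b; split; rewrite ?abszN //.
by rewrite rmorphN mulrNN.
Qed.

(** Inversion exchanges the roles of [a] and [b], hence of rows and columns:
    [a * (- 1 / z) + b = (b * z - a) / z]. *)
Lemma ferrers_young_inv {R : realType} {la : seq nat} {z : R[i]} (w : R[i]) :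
  is_partition la -> z != 0 ->
  ferrers_young la (- (1 / z)) w <-> ferrers_young (conj_part la) z (w * z).
Proof.
move=> pla z0; rewrite !ferrers_youngE //; last exact: conj_part_partition.
split=> -[a [b [E a0 b0 lt_ab]]].
  exists b, (- a); rewrite oppr_eq0 abszN nth_conj_part //; split=> //.
  by rewrite E mulrDl mulrN mulNr -mulrA div1r mulVf // mulr1 rmorphN addrC.
exists (- b), a; rewrite oppr_eq0 abszN -nth_conj_part //; split=> //.
rewrite -[w](mulfK z0) E rmorphN mulrNN mulrDl mulfK // div1r.
by rewrite addrC.
Qed.

(** All three symmetries are dilations of one lattice onto another:
    [c = z^-1] for the inversion, [c = 1] for [z |-> - z] and [c = -1] for the
    symmetry about the origin. *)
Lemma eisenstein_part_scale {R : realType} (k : int) {la la' : seq nat}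
    {z z' c : R[i]} : c != 0 ->
  (forall w, ferrers_young la' z' w <-> ferrers_young la z (w / c)) ->
  eisenstein_part k la' z' = c ^ (- k) * eisenstein_part k la z.
Proof.
move=> c0 E; rewrite /eisenstein_part mulrCA; congr (_ * _).
rewrite mulr_fsumr (reindex_fsbig (fun v => c * v) (ferrers_young la z)).
  by apply: eq_fsbigr => v _; rewrite expfzMl.
have Ec v : c * v / c = v by rewrite mulrAC mulfV // mul1r.
split.
- by move=> v /= lav; apply/E; rewrite Ec.
- by move=> v v' _ _ /(mulfI c0).
- move=> w /E law; exists (w / c) => //.
  by rewrite mulrCA mulfV // mulr1.
Qed.

Lemma partition_eisenstein_inv {R : realType} (k : int) (n : nat) (z : R[i]) :
  z != 0 ->
  partition_eisenstein k n (- (1 / z)) = z ^ k * partition_eisenstein k n z.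
Proof.
move=> z0; rewrite /partition_eisenstein mulr_fsumr.
rewrite [RHS](reindex_fsbig conj_part (partitions_of n)).
  apply: eq_fsbigr => la; rewrite inE => -[pla _].
  rewrite (@eisenstein_part_scale _ _ (conj_part la) _ z _ z^-1).
  - by rewrite -invr_expz -expfV invrK.
  - by rewrite invr_eq0.
  - by move=> w; rewrite invrK; exact: ferrers_young_inv.
split.
- move=> la [pla <-]; split; first exact: conj_part_partition.
  exact: sumn_conj_part.
- move=> la mu; rewrite !inE => -[pla _] [pmu _] E.
  by rewrite -(conj_partK pla) E conj_partK.
- move=> la [pla <-]; exists (conj_part la); last exact: conj_partK.
  by split; [exact: conj_part_partition | exact: sumn_conj_part].
Qed.

Lemma partition_eisenstein_opp {R : realType} (k : int) (n : nat) (z : R[i]) :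
  partition_eisenstein k n (- z) = partition_eisenstein k n z.
Proof.
apply: eq_fsbigr => la _.
rewrite (@eisenstein_part_scale _ _ la _ z _ 1) ?oner_eq0 //.
  by rewrite exp1rz mul1r.
move=> w; rewrite divr1; split=> [/ferrers_young_opp|/ferrers_young_opp //].
by rewrite opprK.
Qed.

(** The lattice is symmetric about the origin, so its series equals
    [(-1) ^ (- k)] times itself. *)
Lemma partition_eisenstein_odd {R : realType} (k : int) (n : nat) (z : R[i]) :
  ~~ (2 %| k)%Z -> partition_eisenstein k n z = 0.
Proof.
move=> kodd; rewrite /partition_eisenstein fsbig1 // => la _.
have N1k : (-1) ^ (- k) = -1 :> R[i].
  rewrite -invr_expz; have -> : k = 1 + 2 * (k %/ 2)%Z.
    by move: kodd; lia.
  by rewrite expfzDr ?oppr_eq0 ?oner_eq0 // expr1z -exprz_exp -exprnP sqrrN expr1n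
    exp1rz mulr1 invrN1.
have E := @eisenstein_part_scale R k la la z z (-1) _ _.
have /eqP : eisenstein_part k la z = - eisenstein_part k la z.
  rewrite {1}E ?N1k ?mulN1r ?oppr_eq0 ?oner_eq0 // => w.
  rewrite invrN1 mulrN1; split=> [/ferrers_youngN //|/ferrers_youngN].
  by rewrite opprK.
by rewrite -addr_eq0 -mulr2n mulrn_eq0 /= => /eqP.
Qed.

(** * Subexponential growth *)

(** The product [\prod_(i >= 1) (1 - s^-i)^-1] converges: each factor is
    [1 + x / (1 - x)] with [x = s^-i], at most [expR (x / (1 - s^-1))], and the
    exponents form a geometric series. *)
Lemma euler_prod_bounded {R : realType} {s : R} : 1 < s ->
  exists C : R, forall m, \prod_(i < m) (1 - s^-1 ^+ i.+1)^-1 <= C.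
Proof.
move=> s1; set r := s^-1.
have r0 : 0 < r by rewrite invr_gt0 (lt_trans ltr01).
have r1 : r < 1 by rewrite invf_lt1 // (lt_trans ltr01).
have d0 : 0 < 1 - r by rewrite subr_gt0.
have rS i : r ^+ i.+1 <= r by rewrite exprS ger_pMr // exprn_ile1 ?ltW.
exists (expR (r / (1 - r) ^+ 2)) => m.
apply: (@le_trans _ _ (expR ((1 - r ^+ m) * (r / (1 - r) ^+ 2)))); last first.
  rewrite ler_expR ler_piMl //; last by rewrite gerBl exprn_ge0 // ltW.
  by rewrite divr_ge0 ?exprn_ge0 // ltW.
elim: m => [|m IH]; first by rewrite big_ord0 subrr mul0r expR0.
rewrite big_ord_recr /=.
have x1 : 0 < 1 - r ^+ m.+1 by rewrite subr_gt0 (le_lt_trans (rS m)).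
have -> : (1 - r ^+ m.+1) * (r / (1 - r) ^+ 2) =
    (1 - r ^+ m) * (r / (1 - r) ^+ 2) + r ^+ m.+1 / (1 - r).
  by rewrite exprS; field; rewrite gt_eqF.
rewrite expRD; apply: ler_pM; rewrite ?invr_ge0 ?(ltW x1) //.
  apply: prodr_ge0 => i _.
  by rewrite invr_ge0 subr_ge0 (le_trans (rS i)) // ltW.
apply: le_trans (expR_ge1Dx _).
have -> : (1 - r ^+ m.+1)^-1 = 1 + r ^+ m.+1 / (1 - r ^+ m.+1).
  by field; rewrite gt_eqF.
by rewrite lerD2l ler_pM2l ?exprn_gt0 // lef_pV2 ?posrE // lerD2l lerN2.
Qed.

(** Splitting off a largest part equal to [m.+1] gives
    [p (m.+1) n <= p m n + p (m.+1) (n - m.+1)] for the number [p m n] of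
    partitions of [n] with parts at most [m], which is why the bound with the
    truncated Euler product propagates. *)
Lemma bounded_partition_list {R : realType} {s : R} (m n : nat) : 1 < s ->
  exists2 L : seq (seq nat),
    forall la, is_partition la -> sumn la = n -> all (geq m) la -> la \in L &
    (size L)%:R <= \prod_(i < m) (1 - s^-1 ^+ i.+1)^-1 * s ^+ n.
Proof.
move=> s1; have s0 : 0 < s by rewrite (lt_trans ltr01).
have r0 : 0 <= s^-1 by rewrite invr_ge0 ltW.
have f0 i : 0 < 1 - s^-1 ^+ i.+1.
  by rewrite subr_gt0 exprVn invf_lt1 ?exprn_gt0 ?exprn_egt1.
elim: m n => [|m IHm] n.
  exists [:: [::]]; last by rewrite big_ord0 mul1r exprn_ege1 // ltW.
  move=> [|x la] /andP[_]; first by rewrite mem_head.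
  by rewrite inE negb_or => /andP[+ _] _ /= /andP[+ _]; case: x.
elim/ltn_ind: n => n IHn; have [L1 L1P L1s] := IHm n.
have small la : is_partition la -> all (geq m.+1) la ->
    all (geq m) la \/ exists2 la', la = m.+1 :: la' & is_partition la'.
  case: la => [|x la]; first by left.
  move=> /andP[/= sla]; rewrite inE negb_or => /andP[x0 la0] /andP[].
  rewrite leq_eqVlt => /orP[/eqP ->|xm] _.
    by right; exists la => //; apply/andP; split=> //; exact: path_sorted sla.
  left; rewrite -ltnS xm /=; apply/allP => y yla.
  have geq_tr : transitive geq by move=> ? ? ? /= h h'; exact: leq_trans h' h.
  move: sla; rewrite path_sortedE // => /andP[/allP/(_ y yla) /= yx _].
  exact: leq_trans yx xm.
have [mn|nm] := ltnP m n; last first.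
  exists L1.
    move=> la pla Sla /(small _ pla)[|[la' Ela _]]; first exact: L1P.
    by move: Sla nm; rewrite Ela /= => <-; lia.
  apply: le_trans L1s _; rewrite big_ord_recr /= ler_wpM2r ?exprn_ge0 ?(ltW s0) //.
  apply: ler_peMr; last by rewrite invf_ge1 // gerBl exprn_ge0.
  by apply: prodr_ge0 => i _; rewrite invr_ge0 ltW.
have [|L2 L2P L2s] := IHn (n - m.+1)%N; first by lia.
exists (L1 ++ map (cons m.+1) L2).
  move=> la pla Sla le_la; rewrite mem_cat.
  have [/L1P -> //|[la' Ela pla']] := small _ pla le_la.
  apply/orP; right; rewrite Ela map_f // L2P //.
    by move: Sla; rewrite Ela /=; lia.
  by move: le_la; rewrite Ela => /andP[].
rewrite size_cat size_map natrD; apply: le_trans (lerD L1s L2s) _.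
rewrite big_ord_recr /= expfB_cond ?gt_eqF //.
set P := \prod_(i < m) _; set x := s^-1 ^+ m.+1.
have -> : s ^+ n / s ^+ m.+1 = s ^+ n * x by rewrite /x exprVn.
suff -> : P * s ^+ n + P * (1 - x)^-1 * (s ^+ n * x) = P * (1 - x)^-1 * s ^+ n by [].
by field; rewrite gt_eqF // f0.
Qed.

Lemma partition_list {R : realType} {s : R} : 1 < s ->
  exists C : R, forall n, exists2 L : seq (seq nat),
    forall la, partitions_of n la -> la \in L & (size L)%:R <= C * s ^+ n.
Proof.
move=> s1; have s0 : 0 < s by rewrite (lt_trans ltr01).
have [C CP] := euler_prod_bounded s1; exists C => n.
have [L LP Ls] := bounded_partition_list n n s1; exists L.
  move=> la [pla Sla]; apply: LP => //; rewrite -Sla; apply/allP => x.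
  by elim: la {pla Sla} => //= y la IH; rewrite inE => /orP[/eqP ->|/IH /=]; lia.
by apply: le_trans Ls _; rewrite ler_wpM2r // exprn_ge0 // ltW.
Qed.

(** With [s = expR a], the inequality [x <= expR x] at [x = n.+1 * a / e.+1],
    raised to the power [e.+1], bounds [n.+1 ^ e.+1]. *)
Lemma poly_subexponential {R : realType} (e : nat) {s : R} : 1 < s ->
  exists C : R, forall n : nat, n.+1%:R ^+ e.+1 <= C * s ^+ n.
Proof.
move=> s1; have s0 : 0 < s by rewrite (lt_trans ltr01).
set b := ln s / e.+1%:R.
have b0 : 0 < b by rewrite divr_gt0 ?ln_gt0 ?ltr0n.
exists (s / b ^+ e.+1) => n.
have Es : s = expR b ^+ e.+1.
  by rewrite -expRM_natl mulrCA mulfV ?pnatr_eq0 // mulr1 lnK // posrE.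
rewrite mulrAC -exprS ler_pdivlMr ?exprn_gt0 // -exprMn.
rewrite {1}Es exprAC -(expRM_natl n.+1 b).
have nb0 : 0 <= n.+1%:R * b by rewrite mulr_ge0 // ltW.
rewrite lerXn2r ?nnegrE ?expR_ge0 //.
by apply: le_trans (expR_ge1Dx _); rewrite lerDr.
Qed.

(** * Convergence of the generating function *)

Lemma fsum_norm_le {K : numFieldType} {I : choiceType} {P : set I}
    {L : seq I} {F : I -> K} {B : K} : 0 <= B ->
  (forall i, P i -> i \in L) -> (forall i, P i -> `|F i| <= B) ->
  `|\sum_(i \in P) F i| <= (size L)%:R * B.
Proof.
move=> B0 PL PB.
have Pfin : finite_set P.
  by apply: (sub_finite_set (B := [set` L])) => // i /PL.
rewrite fsbig_finite //=; apply: le_trans (ler_norm_sum _ _ _) _.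
have PX i : i \in finmap.enum_fset (fset_set P) -> P i.
  by move=> h; apply: set_mem; rewrite -(in_fset_set Pfin).
have Xs : (size (finmap.enum_fset (fset_set P)) <= size L)%N.
  by apply: uniq_leq_size => // i /PX /PL.
apply: (@le_trans _ _ (\sum_(i <- finmap.enum_fset (fset_set P)) B)).
  by rewrite big_seq [leRHS]big_seq; apply: ler_sum => i /PX /PB.
by rewrite big_const_seq count_predT iter_addr addr0 -[leLHS]mulr_natl
  ler_wpM2r // ler_nat.
Qed.

Lemma norm_exprz_le {K : numFieldType} {x B : K} (m : int) :
  `|x| <= B -> `|x^-1| <= B -> `|x ^ m| <= B ^+ `|m|.
Proof.
move=> xB xVB; have B0 : 0 <= B by exact: le_trans xB.
case: m => m; first by rewrite -exprnP normrX lerXn2r // nnegrE.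
by rewrite NegzE -exprnN -exprVn normrX abszN lerXn2r // nnegrE.
Qed.

Lemma normc_ge_Im {R : rcfType} (x : R[i]) :
  `|complex.Im x|%:C%C <= `|x|.
Proof.
have := normc_ge_Re (x * 'i%C).
by rewrite ReiNIm normrN normrM complexiE normCi mulr1.
Qed.

(** A lattice point [a * z + b] has modulus at most [n * (`|z| + 1)] and at
    least [`|Im z|], as [a != 0]; the choice [D = `|z| + 1 + `|Im z|^-1] covers
    both signs of [m]. As [`|a|] and [`|b|] are at most [n], the lattice has at
    most [(2 n + 1) ^ 2 <= 4 (n + 1) ^ 2] points, and the factor [4] cancels the
    [1 / 4] of the definition. *)
Lemma eisenstein_part_le {R : realType} (m : int) {z : R[i]} :
  complex.Im z != 0 ->
  exists2 D : R, 0 <= D & forall n la, partitions_of n la ->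
    `|eisenstein_part m la z| <=
      (n.+1%:R ^+ 2 * (n.+1%:R * D) ^+ `|m|)%:C%C.
Proof.
move=> z0; pose X := complex.Re `|z|; pose y := `|complex.Im z|.
have XE : `|z| = X%:C%C by rewrite RRe_real // realE normr_ge0.
have X0 : 0 <= X by rewrite -ler0c -XE.
have y0 : 0 < y by rewrite normr_gt0.
have D0 : 0 <= X + 1 + y^-1 by rewrite !addr_ge0 // invr_ge0 ltW.
exists (X + 1 + y^-1) => // n la [pla Sla].
have le_n i : (nth 0%N la i <= n)%N.
  rewrite -Sla {pla Sla}; elim: la i => [|x la IH] [|i] //=; first exact: leq_addr.
  by apply: leq_trans (IH i) _; exact: leq_addl.
have size_n : (size la <= n)%N.
  move: pla => /andP[_]; rewrite -Sla {Sla le_n}; elim: la => //= x la IH.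
  by rewrite inE negb_or => /andP[x0 /IH]; lia.
pose zs : seq int := [seq (i%:Z - n%:Z)%R | i <- iota 0 (n.*2.+1)].
have zsP (a : int) : (`|a| <= n)%N -> a \in zs.
  move=> an; apply/mapP; exists (absz (a + n%:Z)); last by lia.
  by rewrite mem_iota; lia.
pose L := [seq a%:~R * z + b%:~R | a <- zs, b <- zs].
have LP w : ferrers_young la z w -> w \in L.
  move=> [a [b [-> /andP[_ bs] /andP[_ al]]]].
  apply: (allpairs_f (fun a b : int => a%:~R * z + b%:~R)); apply: zsP.
    exact: leq_trans al (le_n _).
  exact: leq_trans bs size_n.
set B := (n.+1%:R * (X + 1 + y^-1)).
have B0 : 0 <= B by rewrite mulr_ge0.
have wB w : ferrers_young la z w -> `|w ^ (- m)| <= (B ^+ `|m|)%:C%C.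
  move=> [a [b [-> /andP[_ bs] /andP[a0 al]]]].
  rewrite -abszN rmorphXn; apply: norm_exprz_le.
    apply: le_trans (ler_normD _ _) _; rewrite normrM XE -!intr_norm.
    rewrite -!natr_absz -!(rmorph_nat (real_complex R)) -rmorphM -rmorphD lecR.
    have an : (`|a|%:R <= n.+1%:R :> R).
      by rewrite ler_nat (leq_trans al) // (leq_trans (le_n _)).
    have bn : (`|b|%:R <= n.+1%:R :> R).
      by rewrite ler_nat (leq_trans bs) // (leq_trans size_n).
    rewrite /B !mulrDr mulr1.
    apply: (@le_trans _ _ (n.+1%:R * X + n.+1%:R)).
      by rewrite lerD // ler_wpM2r.
    by rewrite lerDl mulr_ge0 // invr_ge0 ltW.
  have yw : y%:C%C <= `|a%:~R * z + b%:~R|.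
    apply: le_trans (normc_ge_Im _); rewrite lecR.
    have -> : complex.Im (a%:~R * z + b%:~R) = a%:~R * complex.Im z.
      by rewrite -!(rmorph_int (real_complex R)); case: (z) => u v /=; ring.
    by rewrite normrM ler_peMl ?(ltW y0) // -intr_norm -natr_absz ler1n.
  have w0 : 0 < `|a%:~R * z + b%:~R| by rewrite (lt_le_trans _ yw) // ltcR.
  rewrite normfV; apply: (@le_trans _ _ (y^-1)%:C%C).
    by rewrite fmorphV lef_pV2 // posrE ltcR.
  rewrite lecR /B mulrDr.
  apply: (@le_trans _ _ (n.+1%:R * y^-1)).
    by rewrite ler_peMl ?ler1n // invr_ge0 ltW.
  by rewrite lerDr mulr_ge0 // addr_ge0.
rewrite /eisenstein_part normrM.
have Bm0 : 0 <= (B ^+ `|m|)%:C%C by rewrite ler0c exprn_ge0.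
apply: le_trans (ler_wpM2l (normr_ge0 _) (fsum_norm_le Bm0 LP wB)) _.
rewrite mulrA rmorphM ler_wpM2r // size_allpairs size_map size_iota.
rewrite ger0_norm ?invr_ge0 ?ler0n // ler_pdivrMl ?ltr0n //.
rewrite rmorphXn rmorph_nat -natrX -natrM ler_nat.
by lia.
Qed.

(** The allowance [t ^ n] is shared equally, as [Num.sqrt t ^ n] each, between
    the number of partitions and the polynomial bound on each of them. *)
Lemma partition_eisenstein_le {R : realType} (m : int) {z : R[i]} {t : R} :
  complex.Im z != 0 -> 1 < t ->
  exists C : R, forall n, `|partition_eisenstein m n z| <= (C * t ^+ n)%:C%C.
Proof.
move=> z0 t1; have t0 : 0 < t by rewrite (lt_trans ltr01).
have [D D0 fP] := eisenstein_part_le m z0.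
have s1 : 1 < Num.sqrt t by rewrite -[ltLHS]sqrtr1 ltr_sqrt.
have [C CP] := partition_list s1.
have [C' C'P] := poly_subexponential `|m|.+1 s1.
exists (C * C' * D ^+ `|m|) => n; have [L LP Ls] := CP n.
have B0 : 0 <= n.+1%:R ^+ 2 * (n.+1%:R * D) ^+ `|m| by rewrite mulr_ge0 ?exprn_ge0 ?mulr_ge0.
rewrite -ler0c in B0.
apply: le_trans (fsum_norm_le B0 LP (fP n)) _.
rewrite -(rmorph_nat (real_complex R)) -rmorphM lecR.
rewrite exprMn [n.+1%:R ^+ 2 * _]mulrA -exprD.
have -> : t ^+ n = Num.sqrt t ^+ n * Num.sqrt t ^+ n.
  by rewrite -exprMn -expr2 sqr_sqrtr // ltW.
have -> : C * C' * D ^+ `|m| * (Num.sqrt t ^+ n * Num.sqrt t ^+ n) =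
  C * Num.sqrt t ^+ n * (C' * Num.sqrt t ^+ n * D ^+ `|m|) by ring.
apply: ler_pM => //; first by apply: mulr_ge0; exact: exprn_ge0.
by rewrite ler_wpM2r ?exprn_ge0 // add2n.
Qed.

(** Real and imaginary parts converge absolutely in the complete field [R],
    and their sums are reassembled. *)
Lemma cvg_complex_series {R : realType} {u : nat -> R[i]} {C r : R} :
  `|r| < 1 -> (forall n, `|u n| <= (C * r ^+ n)%:C%C) ->
  cvgn (fun N => (\sum_(1 <= n < N) u n : R[i]^o)).
Proof.
move=> r1 uP.
have cvg_real (v : nat -> R) : (forall n, `|v n|%:C%C <= `|u n|) ->
    cvgn (fun N => \sum_(1 <= n < N) v n).
  move=> vu; rewrite is_cvg_series_restrict; apply: normed_cvg.
  apply: (@series_le_cvg _ (fun n => `|v n|) (geometric C r)) => [//|n|n|] /=.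
  - by rewrite -ler0c (le_trans _ (uP n)).
  - by rewrite -lecR (le_trans (vu n)).
  - exact: is_cvg_geometric_series.
have /cvg_ex[/= a aP] := cvg_real _ (fun n => normc_ge_Re (u n)).
have /cvg_ex[/= b bP] := cvg_real _ (fun n => normc_ge_Im (u n)).
apply/cvg_ex; exists (a%:C + 'i * b%:C)%C.
apply/cvgrPdist_lt => e e0.
have eE : e = (complex.Re e)%:C%C by rewrite RRe_real // realE ltW.
have e20 : 0 < complex.Re e / 2 by rewrite divr_gt0 // -ltcR -eE.
move/cvgrPdist_lt : aP => /(_ _ e20) aP.
move/cvgrPdist_lt : bP => /(_ _ e20) bP.
near=> N.
have -> : \sum_(1 <= n < N) u n = (\sum_(1 <= n < N) complex.Re (u n))%:C%C +
    'i%C * (\sum_(1 <= n < N) complex.Im (u n))%:C%C.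
  rewrite !raddf_sum mulr_sumr -big_split; apply: eq_bigr => n _.
  exact: complexE.
rewrite opprD addrACA -mulrBr -!rmorphB.
apply: le_lt_trans (ler_normD _ _) _.
rewrite normrM normCi mul1r.
have normr_C (x : R) : `|x%:C%C| = `|x|%:C%C.
  by rewrite normc_def /= expr0n addr0 sqrtr_sqr.
rewrite !normr_C -rmorphD eE ltcR [ltRHS]splitr ltrD //.
- by near: N; exact: aP.
- by near: N; exact: bP.
Unshelve. all: by end_near. Qed.

Lemma is_cvg_eisenstein_gf {R : realType} (m : int) {z q : R[i]} :
  complex.Im z != 0 -> `|q| < 1 -> cvgn (eisenstein_gf_partial m z q).
Proof.
move=> z0 q1; pose r := complex.Re `|q|.
have rE : `|q| = r%:C%C by rewrite RRe_real // realE normr_ge0.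
have r0 : 0 <= r by rewrite -ler0c -rE.
have r1 : r < 1 by rewrite -ltcR -rE.
have r10 : 0 < 1 + r by lra.
have t1 : 1 < 2 / (1 + r) by rewrite ltr_pdivlMr //; lra.
have [C CP] := partition_eisenstein_le m z0 t1.
apply: (@cvg_complex_series _ _ C (2 / (1 + r) * r)).
  rewrite ger0_norm; last by rewrite mulr_ge0 // divr_ge0 // ltW.
  by rewrite mulrAC ltr_pdivrMr //; lra.
move=> n; rewrite normrM normrX rE exprMn mulrA rmorphM /= rmorphXn.
by rewrite ler_wpM2r // exprn_ge0 // ler0c.
Qed.

(** * The generating function *)

Theorem corollary2 (R : realType) (k : int) (z q : R[i])
    (hz : complex.Im z != 0) (hq : `|q| < 1) :
  [/\ (* the series defining the generating function converges on the disc *)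
      forall (m : int) (w : R[i]), complex.Im w != 0 ->
        cvgn (eisenstein_gf_partial m w q),
      ~~ (2 %| k)%Z -> eisenstein_gf k z q = 0,
      eisenstein_gf (2 * k) (- (1 / z)) q = z ^ (2 * k) * eisenstein_gf (2 * k) z q
    & eisenstein_gf (2 * k) (- z) q = eisenstein_gf (2 * k) z q].
Proof.
split.
- by move=> m w w0; exact: is_cvg_eisenstein_gf.
- move=> kodd; rewrite /eisenstein_gf.
  have -> : eisenstein_gf_partial k z q = fun=> 0.
    apply/funext => N; rewrite /eisenstein_gf_partial big1 // => n _.
    by rewrite partition_eisenstein_odd // mul0r.
  by apply: (@cvg_lim R[i]^o); [exact: norm_hausdorff | exact: cvg_cst].
- have z0 : z != 0 by apply: contraNneq hz => ->.
  rewrite /eisenstein_gf.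
  have -> : eisenstein_gf_partial (2 * k) (- (1 / z)) q =
      z ^ (2 * k) *: eisenstein_gf_partial (2 * k) z q.
    apply/funext => N; rewrite /eisenstein_gf_partial fctE [RHS]mulr_sumr.
    by apply: eq_bigr => n _; rewrite partition_eisenstein_inv // mulrA.
  by rewrite limZl_tmp //; exact: is_cvg_eisenstein_gf.
- rewrite /eisenstein_gf.
  suff -> : eisenstein_gf_partial (2 * k) (- z) q =
      eisenstein_gf_partial (2 * k) z q by [].
  apply/funext => N; apply: eq_bigr => n _.
  by rewrite partition_eisenstein_opp.
Qed.
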